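(* Let $p \in \mathbb{R}_{\geq 0}[x_1,\ldots,x_n]$ be $n$-homogeneous (homogeneous of degree $n$) and strongly log-concave. If $$\partial_{x_1} \cdots \partial_{x_n} p(\boldsymbol{x}) = \frac{n!}{n^n} \operatorname{Cap}_{\boldsymbol{1}}(p) > 0,$$ then for $\boldsymbol{v} = \frac{\nabla p(\boldsymbol{1})}{n}$ we have $p(\boldsymbol{x}) = \left(\sum_i v_i x_i\right)^n$.
   Context: $\mathbb{R}_{\geq 0}[x_1,\ldots,x_n]$ denotes polynomials with non-negative real coefficients, and $\boldsymbol{1}$ is the all-ones vector. A homogeneous polynomial $p \in \mathbb{R}_{\geq 0}[x_1,\ldots,x_n]$ is strongly log-concave (SLC) if for every $\boldsymbol\alpha \in \mathbb{Z}_{\geq 0}^n$ the polynomial $\partial_{x_1}^{\alpha_1} \cdots \partial_{x_n}^{\alpha_n} p$ is either log-concave on $\mathbb{R}_{>0}^n$ or identically zero. The capacity is $\operatorname{Cap}_{\boldsymbol{1}}(p) = \inf_{\boldsymbol{x} \in \mathbb{R}_{>0}^n} \frac{p(\boldsymbol{x})}{x_1 x_2 \cdots x_n}$. Since $p$ has degree $n$, $\partial_{x_1} \cdots \partial_{x_n} p$ is a constant, equal to the coefficient of $x_1 \cdots x_n$ in $p$.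
   Formalization: The printed identity fails for p = (x1+x2)^2, where v = (2,2); it is proved under the added condition p(1) = 1, and for every p the scale-invariant form p = p(1)·(Σ (v_i/p(1)) x_i)^n is proved instead. *)

(* Defs.v *)
From HB Require Import structures.
From mathcomp Require Import all_boot all_order all_algebra.
From mathcomp Require Import boolp classical_sets reals exp.
From mathcomp Require Import mpoly.

Set Implicit Arguments.
Unset Strict Implicit.
Unset Printing Implicit Defensive.

Import Order.TTheory GRing.Theory Num.Theory.

Local Open Scope classical_set_scope.
Local Open Scope ring_scope.

Section Defs.
Variables (R : realType) (n : nat).
Implicit Types (p : {mpoly R[n]}) (x y : 'I_n -> R).

Definition nonneg_coeffs p := forall m : 'X_{1..n}, 0 <= p@_m.

Definition positive_orthant : set ('I_n -> R) := [set x | forall i, 0 < x i].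

(* Since [ln] is 0 outside the positive reals, positivity is required
   explicitly; it is automatic for a nonzero polynomial with non-negative
   coefficients. *)
Definition log_concave_on (D : set ('I_n -> R)) (f : ('I_n -> R) -> R) :=
  (forall x, D x -> 0 < f x) /\
  (forall x y (t : R), D x -> D y -> 0 <= t <= 1 ->
     t * ln (f x) + (1 - t) * ln (f y)
       <= ln (f (fun i => t * x i + (1 - t) * y i))).

(* Only meant for homogeneous [p] with non-negative coefficients. *)
Definition strongly_log_concave p :=
  forall a : 'X_{1..n},
    log_concave_on positive_orthant (fun x => (p^`M[a]).@[x])
    \/ p^`M[a] = 0.

Definition cap1 p : R :=
  inf [set p.@[x] / \prod_(i < n) x i | x in positive_orthant].

Definition gradient p x (i : 'I_n) : R := (p^`M(i)).@[x].

Definition ones : 'I_n -> R := fun=> 1.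

End Defs.

Arguments positive_orthant {R n}.
Arguments ones {R n}.

(* Main.v *)
Require Import Defs.
From HB Require Import structures.
From mathcomp Require Import all_boot all_order all_algebra.
From mathcomp Require Import boolp classical_sets reals exp.
From mathcomp Require Import mpoly.
From mathcomp Require Import ring lra.

(** The idea follows Gurvits' capacity method.  A homogeneous log-concave
    polynomial of degree [d] has a concave [d]-th root, which is encoded as
    [superadditive].  Let [F] have degree [d] in [d] variables and let
    [F >= C * x_1 ... x_d] on the orthant.  Comparing the slope at [t = 0] of the
    concave function [F(x, t)^(1/d)] with a chord shows that [F^`M(k)],
    restricted to [x_k = 0], dominates [C * ((d-1)/d)^(d-1)] times the product of
    the remaining variables ([capacity_descent]).  Iterating, the coefficient of
    the squarefree monomial is at least [d!/d^d * C] ([capacity_inequality]).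

    In the equality case every step is tight.  By induction [F^`M(k)] restricted
    to [x_k = 0] is a power of a linear form, whose capacity is attained at some
    [x0].  Tightness at [x0] forces [F] to be, on the line from [x0] in the
    direction [e_k], the [d]-th power of an affine function
    ([capacity_descent_eq]).  This gives the value of [F^`M(k)] at [e_k], so
    the concave root of [F^`M(k)] lies above a linear form; both agree at an
    interior point, hence everywhere ([superadditive_touching]).  Thus [F] and the
    [d]-th power [P] of a linear form have the same derivative in [x_k].

    It remains to compare the coefficients of the monomials without [x_k].
    Such a monomial has degree [d] in [d - 1] variables, hence contains some
    [x_i^2]; the derivative of [F] that leaves only this square is a quadratic
    form, and its log-concavity in the variables [x_i], [x_k] shows that the
    coefficient of [F] is at most the one of [P] ([mcoeff_le_linform_exp]).
    Since [F] and [P] agree at a point with positive coordinates, they are equal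
    ([eq_linform_exp]).

    The induction runs over sets [S] of variables: instead of substituting [0]
    for a variable, polynomials are evaluated on the face [cone S] of the
    orthant. *)

Set Implicit Arguments.
Unset Strict Implicit.
Unset Printing Implicit Defensive.

Import Order.TTheory GRing.Theory Num.Theory.

Local Open Scope ring_scope.

(** * Univariate polynomials and restriction to lines *)

Section Univariate.
Variable R : realType.
Implicit Types (u : {poly R}) (c e t : R).

(** A weak inequality passes to the limit at [0], because close to [0]
    the increment of a polynomial is at most linear. *)
Lemma horner_ge_at0 u c e : 0 < e ->
  (forall t, 0 < t <= e -> c <= u.[t]) -> c <= u.[0].
Proof.
move=> e_gt0 u_ge; rewrite leNgt; apply/negP => lt_u0c.
have /factor_theorem [q uE] : root (u - u.[0]%:P) 0.
  by rewrite rootE !hornerE subrr.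
have {}uE t : u.[t] = u.[0] + q.[t] * t.
  by have := congr1 (fun w => w.[t]) uE; rewrite !hornerE; lra.
have [B qB] := poly_itv_bound q 0 e.
pose t := Num.min e ((c - u.[0]) / (`|B| + 1) / 2).
have B1_gt0 : 0 < `|B| + 1 by rewrite ltr_wpDl.
have t_gt0 : 0 < t by rewrite lt_min e_gt0 !divr_gt0 // subr_gt0.
have t_le : t <= e by rewrite ge_min lexx.
have := u_ge t; rewrite t_gt0 t_le => /(_ isT).
rewrite uE => c_le.
have q_le : q.[t] <= `|B| + 1.
  apply: le_trans (ler_norm _) _; apply: le_trans (qB t _) _.
    by rewrite ltW.
  by apply: le_trans (ler_norm _) _; rewrite lerDl.
have tle : t * (`|B| + 1) <= (c - u.[0]) / 2.
  rewrite -ler_pdivlMr // mulrAC; rewrite ge_min; apply/orP; right.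
  by rewrite mulrAC.
have := ler_wpM2r (ltW t_gt0) q_le.
by move: tle c_le lt_u0c; set a := q.[t] * t; set b := u.[0]; nra.
Qed.

Lemma poly_eq0_itv u e : 0 < e ->
  (forall t, 0 < t <= e -> u.[t] = 0) -> u = 0.
Proof.
move=> e_gt0 u0; apply/eqP/negPn/negP => u_neq0.
pose s := [seq e / (i.+1)%:R | i <- iota 0 (size u)].
have := @max_poly_roots _ u s u_neq0.
rewrite size_map size_iota ltnn => H; apply/notF/H.
- apply/allP => t /mapP[i _ ->]; apply/rootP/u0.
  rewrite divr_gt0 ?ltr0Sn //= ler_pdivrMr ?ltr0Sn // ler_peMr ?(ltW e_gt0) //.
  by rewrite ler1n.
- rewrite map_inj_uniq ?iota_uniq // => i j /(mulfI (lt0r_neq0 e_gt0)) /invr_inj.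
  by move/eqP; rewrite eqr_nat eqSS => /eqP.
Qed.

Lemma poly_eq_itv u w e : 0 < e ->
  (forall t, 0 < t <= e -> u.[t] = w.[t]) -> u = w.
Proof.
move=> e_gt0 uw; apply/eqP; rewrite -subr_eq0; apply/eqP.
by apply: (poly_eq0_itv e_gt0) => t /uw; rewrite !hornerE => ->; rewrite subrr.
Qed.

Lemma horner_deriv0_ge u c e : 0 < e ->
  (forall t, 0 < t <= e -> u.[0] + t * c <= u.[t]) -> c <= u^`().[0].
Proof.
move=> e_gt0 u_ge.
have /factor_theorem [q uE] : root (u - u.[0]%:P) 0.
  by rewrite rootE !hornerE subrr.
have {}uE : u = u.[0]%:P + q * 'X by rewrite -[LHS](subrK u.[0]%:P) uE subr0 addrC.
have -> : u^`().[0] = q.[0].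
  by rewrite {1}uE !derivE !hornerE /=; ring.
apply: (horner_ge_at0 e_gt0) => t t_itv; have /andP[t_gt0 _] := t_itv.
have := u_ge t t_itv; rewrite {2}uE !hornerE lerD2l mulrC ler_pM2r //.
Qed.

Lemma exp_root (d : nat) c : 0 <= c -> exists2 b : R, 0 <= b & b ^+ d.+1 = c.
Proof.
move=> c_ge0; exists (c `^ (d.+1%:R)^-1); first exact: powR_ge0.
by rewrite -powR_mulrn ?powR_ge0 // -powRrM mulVf ?pnatr_eq0 // powRr1.
Qed.

(** Bernoulli's inequality, homogenized so that [a = 0] is covered: the graph of
    a power lies above its tangent at [a]. *)
Lemma exprD_ge_tangent (d : nat) (a b : R) : 0 <= a -> 0 <= a + b ->
  a ^+ d.+1 + d.+1%:R * a ^+ d * b <= (a + b) ^+ d.+1.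
Proof.
move=> a_ge0 ab_ge0; elim: d => [|d IHd]; first by rewrite !expr1 expr0; lra.
rewrite [leRHS]exprS.
apply: le_trans (ler_wpM2l ab_ge0 IHd).
rewrite -subr_ge0 [X in 0 <= X](_ : _ = d.+1%:R * a ^+ d * b ^+ 2).
  by rewrite mulr_ge0 ?sqr_ge0 // mulr_ge0 ?exprn_ge0 // ler0n.
by rewrite -(natr1 d.+1) !exprS; ring.
Qed.

End Univariate.

Section Evaluation.
Variables (R : realType) (n : nat).
Implicit Types (F : {mpoly R[n]}) (x y : 'I_n -> R) (S : {set 'I_n}).

Definition delta (k : 'I_n) : 'I_n -> R := fun i => (i == k)%:R.

(** Turns limits and directional derivatives of multivariate polynomials into
    questions about a univariate polynomial. *)
Lemma meval_line F x y : exists u : {poly R}, forall t,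
  u.[t] = F.@[fun i => x i + t * y i] /\
  u^`().[t] = \sum_i y i * F^`M(i).@[fun i => x i + t * y i].
Proof.
pose good F := exists u : {poly R}, forall t,
  u.[t] = F.@[fun i => x i + t * y i] /\
  u^`().[t] = \sum_i y i * F^`M(i).@[fun i => x i + t * y i].
have goodC c : good c%:MP.
  exists c%:P => t; rewrite derivC !hornerE mevalC; split => //.
  by rewrite big1 // => i _; rewrite mderivC meval0 mulr0.
have goodM P Q : good P -> good Q -> good (P * Q).
  move=> [u1 E1] [u2 E2]; exists (u1 * u2) => t.
  have [a1 b1] := E1 t; have [a2 b2] := E2 t.
  rewrite derivM !hornerE a1 a2 b1 b2 mevalM; split => //.
  rewrite mulr_suml mulr_sumr -big_split; apply: eq_bigr => i _ /=.
  by rewrite mderivM mevalD !mevalM; ring.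
have goodD P Q : good P -> good Q -> good (P + Q).
  move=> [u1 E1] [u2 E2]; exists (u1 + u2) => t.
  have [a1 b1] := E1 t; have [a2 b2] := E2 t.
  rewrite derivD !hornerE a1 a2 b1 b2 mevalD; split => //.
  rewrite -big_split; apply: eq_bigr => i _ /=.
  by rewrite mderivD mevalD mulrDr.
have goodX i : good 'X_i.
  exists ((x i)%:P + y i *: 'X) => t.
  rewrite mevalXU !derivE !hornerE; split; first by rewrite mulrC.
  rewrite (bigD1 i) //= big1 => [|j /negPf ji].
    rewrite addr0 mderivX mnm1E eqxx scale1r.
    by rewrite -[X in (X - _)%MM]addm0 addmC addmK mpolyX0 meval1 mulr1.
  by rewrite mderivX mnm1E eq_sym ji scale0r meval0 mulr0.
have good1 : good 1 by rewrite -mpolyC1.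
rewrite -/(good F).
elim/mpolyind: F => [|c m G _ _ gG]; first by rewrite -mpolyC0.
apply: (goodD) => //; rewrite -mul_mpolyC; apply: (goodM) => //.
rewrite mpolyXE_id; apply: (big_ind good good1 goodM) => i _.
by elim: (m i) => [|e IHe]; rewrite ?expr0 // exprS; apply: (goodM).
Qed.

Lemma meval_coord_line F x k : exists u : {poly R}, forall t,
  u.[t] = F.@[fun i => x i + t * delta k i] /\
  u^`().[t] = F^`M(k).@[fun i => x i + t * delta k i].
Proof.
have [u uE] := meval_line F x (delta k); exists u => t; have [-> ->] := uE t.
split=> //; rewrite (bigD1 k) //= /delta eqxx mul1r big1 ?addr0 // => i /negPf ->.
by rewrite mul0r.
Qed.

Lemma meval_homog d F c x : F \is d.-homog ->
  F.@[fun i => c * x i] = c ^+ d * F.@[x].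
Proof.
move=> /dhomogP F_d; rewrite !mevalE mulr_sumr; apply: eq_big_seq => m /F_d /= <-.
rewrite [mdeg m]mdegE -prodrXr mulrCA -big_split /=; congr (_ * _).
by apply: eq_bigr => i _; rewrite exprMn.
Qed.

Lemma meval_ge0 F x : nonneg_coeffs F -> (forall i, 0 <= x i) -> 0 <= F.@[x].
Proof.
move=> F_ge0 x_ge0; rewrite mevalE; apply: sumr_ge0 => m _.
by rewrite mulr_ge0 // prodr_ge0 // => i _; rewrite exprn_ge0.
Qed.

Lemma meval_le F x y : nonneg_coeffs F -> (forall i, 0 <= x i) ->
  (forall i, x i <= y i) -> F.@[x] <= F.@[y].
Proof.
move=> F_ge0 x_ge0 xy; rewrite !mevalE; apply: ler_sum => m _.
apply: ler_wpM2l => //; apply: ler_prod => i _.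
by rewrite exprn_ge0 //= lerXn2r // ?nnegrE // (le_trans (x_ge0 i)).
Qed.

Lemma mderivm_ge0 F m : nonneg_coeffs F -> nonneg_coeffs F^`M[m].
Proof. by move=> F_ge0 m'; rewrite mcoeff_mderivm mulrn_wge0. Qed.

Lemma mderivm_homog d F m : F \is (mdeg m + d).-homog -> F^`M[m] \is d.-homog.
Proof.
move=> F_d; apply/dhomogP => m'; rewrite mcoeff_msupp mcoeff_mderivm.
apply: contraNeq => m'_neq; rewrite (dhomog_nemf_coeff F_d) ?mul0rn //.
by rewrite [X in X != _]mdegD eqn_add2l.
Qed.

End Evaluation.

(** * Log-concavity as superadditivity *)

Section Superadditive.
Variables (R : realType) (n : nat).
Implicit Types (F : {mpoly R[n]}) (x y : 'I_n -> R) (S : {set 'I_n}).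

(** Superadditivity of the [d]-th root of [F] on the closed orthant, written
    without roots.  For a homogeneous polynomial this is log-concavity; unlike
    the latter it makes sense, and stays true, on the boundary, where the
    capacity argument evaluates the derivatives of [p]. *)
Definition superadditive d F := forall x y a b,
  (forall i, 0 <= x i) -> (forall i, 0 <= y i) -> 0 <= a -> 0 <= b ->
  a ^+ d <= F.@[x] -> b ^+ d <= F.@[y] ->
  (a + b) ^+ d <= F.@[fun i => x i + y i].

(** If [F x = a ^+ d] and [F y = b ^+ d], homogeneity makes [F] equal to
    [(a + b) ^+ d] at the two rescaled points [(a + b) / a * x] and
    [(a + b) / b * y], and [x + y] is a convex combination of these two. *)
Lemma log_concave_superadditive d F : nonneg_coeffs F -> F \is d.-homog ->
  log_concave_on positive_orthant (fun x => F.@[x]) -> superadditive d F.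
Proof.
move=> F_ge0 F_d [F_gt0 F_lc].
have interior x y a b : (forall i, 0 < x i) -> (forall i, 0 < y i) ->
    0 < a -> 0 < b -> a ^+ d <= F.@[x] -> b ^+ d <= F.@[y] ->
    (a + b) ^+ d <= F.@[fun i => x i + y i].
  move=> x_gt0 y_gt0 a_gt0 b_gt0 Fx Fy.
  have c_gt0 : 0 < a + b by rewrite addr_gt0.
  have cd_gt0 : 0 < (a + b) ^+ d by rewrite exprn_gt0.
  have scaled z e : 0 < e -> (forall i, 0 < z i) -> e ^+ d <= F.@[z] ->
      ln ((a + b) ^+ d) <= ln F.@[fun i => (a + b) / e * z i].
    move=> e_gt0 z_gt0 Fz; have ce_gt0 : 0 < (a + b) / e by rewrite divr_gt0.
    rewrite ler_ln ?posrE //; last by apply: F_gt0 => i; rewrite mulr_gt0.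
    rewrite (meval_homog _ _ F_d) exprMn exprVn -mulrA ler_peMr ?(ltW cd_gt0) //.
    by rewrite ler_pdivlMl ?exprn_gt0 // mulr1.
  have w_itv : 0 <= a / (a + b) <= 1.
    by rewrite divr_ge0 ?(ltW a_gt0) ?(ltW c_gt0) //= ler_pdivrMr // mul1r lerDl ltW.
  have := F_lc (fun i => (a + b) / a * x i) (fun i => (a + b) / b * y i) _ _ _ w_itv.
  have -> : (fun i => a / (a + b) * ((a + b) / a * x i)
      + (1 - a / (a + b)) * ((a + b) / b * y i)) = (fun i => x i + y i).
    by apply/funext => i; field; rewrite ?lt0r_neq0.
  move=> /(_ _ _)/le_trans H.
  rewrite -ler_ln ?posrE //; last by apply: F_gt0 => i; rewrite addr_gt0.
  have [w_ge0 w_le1] := andP w_itv.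
  apply: le_trans (H _ _ _ (lexx _)); last first.
  - by move=> i /=; rewrite mulr_gt0 ?divr_gt0.
  - by move=> i /=; rewrite mulr_gt0 ?divr_gt0.
  rewrite -[leLHS]mul1r -{1}(subrK (a / (a + b)) 1) addrC mulrDl.
  by apply: lerD; apply: ler_wpM2l; rewrite ?subr_ge0 //; apply: scaled.
move=> x y a b x_ge0 y_ge0 a_ge0 b_ge0 Fx Fy.
have [->|a_neq0] := eqVneq a 0.
  rewrite add0r; apply: le_trans Fy _.
  by apply: meval_le => // i; rewrite lerDr.
have [->|b_neq0] := eqVneq b 0.
  rewrite addr0; apply: le_trans Fx _.
  by apply: meval_le => // i; rewrite lerDl.
(* Boundary points are limits of interior ones. *)
have [u uE] := meval_line F (fun i => x i + y i) (fun=> 2).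
suff : (a + b) ^+ d <= u.[0].
  by rewrite (uE 0).1; congr (_ <= _); apply: meval_eq => i; rewrite mul0r addr0.
apply: (@horner_ge_at0 _ _ _ 1) => // t /andP[t_gt0 _]; rewrite (uE t).1.
rewrite [leRHS](_ : _ = F.@[fun i => (x i + t) + (y i + t)]); last first.
  by apply: meval_eq => i; ring.
apply: interior.
- by move=> i; rewrite ltr_wpDl.
- by move=> i; rewrite ltr_wpDl.
- by rewrite lt0r a_neq0.
- by rewrite lt0r b_neq0.
- by apply: le_trans Fx _; apply: meval_le => // i; rewrite lerDl ltW.
- by apply: le_trans Fy _; apply: meval_le => // i; rewrite lerDl ltW.
Qed.

Lemma superadditive_zero d : superadditive d 0.
Proof.
move=> x y a b _ _ a_ge0 b_ge0; rewrite !meval0; case: d => [|d].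
  by rewrite expr0 ler10.
move=> ad bd; have pow0 (c : R) : 0 <= c -> c ^+ d.+1 <= 0 -> c = 0.
  move=> c_ge0 cd; have : c ^+ d.+1 == 0 by rewrite eq_le cd exprn_ge0.
  by rewrite expf_eq0 => /andP[_ /eqP].
by rewrite (pow0 a) // (pow0 b) // addr0 expr0n.
Qed.

(** The form in which strong log-concavity enters; it passes to partial
    derivatives and needs no rescaling of variables. *)
Definition completely_superadditive d F :=
  [/\ nonneg_coeffs F, F \is d.-homog &
   forall m e, (mdeg m + e)%N = d -> superadditive e F^`M[m]].

Lemma slc_completely_superadditive d F : nonneg_coeffs F -> F \is d.-homog ->
  strongly_log_concave F -> completely_superadditive d F.
Proof.
move=> F_ge0 F_d F_slc; split=> // m e me.
case: (F_slc m) => [F_lc|->]; last exact: superadditive_zero.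
apply: log_concave_superadditive => //; first exact: mderivm_ge0.
by apply: mderivm_homog; rewrite me.
Qed.

Lemma completely_superadditive_deriv d F k : completely_superadditive d.+1 F ->
  completely_superadditive d F^`M(k).
Proof.
rewrite -mderivmU1m => -[F_ge0 F_d F_sup]; split; first exact: mderivm_ge0.
  by apply: mderivm_homog; rewrite mdeg1.
move=> m e me; rewrite -mderivmDm; apply: F_sup.
by rewrite mdegD mdeg1 -addnA me.
Qed.

Lemma completely_superadditive_self d F :
  completely_superadditive d F -> superadditive d F.
Proof. by case=> _ _ /(_ 0%MM d); rewrite mdeg0 mderivm0m; apply. Qed.

End Superadditive.

(** * One step of the capacity descent *)

Section Tangent.
Variables (R : realType) (n : nat).
Implicit Types (F : {mpoly R[n]}) (x y : 'I_n -> R) (S : {set 'I_n}).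

(** The function [F] to the power [1 / d.+1] is concave along the segment from
    [x] to [x + t e_k], so its slope at [x] is at least the slope [B - A] of the
    chord.  Differentiating the root gives the factor [d.+1 * A ^+ d]. *)
Lemma superadditive_tangent d F x k t A B :
  F \is d.+1.-homog -> superadditive d.+1 F ->
  (forall i, 0 <= x i) -> 0 <= t -> 0 <= A -> 0 <= B -> A ^+ d.+1 = F.@[x] ->
  B ^+ d.+1 <= F.@[fun i => x i + t * delta R k i] ->
  d.+1%:R * A ^+ d * (B - A) <= t * F^`M(k).@[x].
Proof.
move=> F_d F_sup x_ge0 t_ge0 A_ge0 B_ge0 FA FB.
have [u uE] := meval_coord_line F x k.
have u0 : u.[0] = A ^+ d.+1.
  by rewrite FA (uE 0).1; apply: meval_eq => i; rewrite mul0r addr0.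
have u'0 : u^`().[0] = F^`M(k).@[x].
  by rewrite (uE 0).2; apply: meval_eq => i; rewrite mul0r addr0.
pose w := u \Po (t *: 'X).
have wE s : w.[s] = u.[t * s] by rewrite horner_comp !hornerE.
have -> : t * F^`M(k).@[x] = w^`().[0].
  rewrite deriv_comp derivZ derivX hornerM horner_comp !hornerE.
  by rewrite -u'0 /= mulr1 mulrC.
apply: (@horner_deriv0_ge _ _ _ 1) => // s /andP[/ltW s_ge0 s_le1].
rewrite !wE mulr0 u0.
have -> : s * (d.+1%:R * A ^+ d * (B - A)) = d.+1%:R * A ^+ d * (s * (B - A)).
  by ring.
have As_ge0 : 0 <= (1 - s) * A by rewrite mulr_ge0 ?subr_ge0.
have Bs_ge0 : 0 <= s * B by rewrite mulr_ge0.
have AB : A + s * (B - A) = (1 - s) * A + s * B by ring.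
apply: le_trans (exprD_ge_tangent _ A_ge0 _) _; first by rewrite AB addr_ge0.
rewrite AB (uE (t * s)).1.
rewrite [leRHS](_ : _ = F.@[fun i => (1 - s) * x i + s * (x i + t * delta R k i)]).
  apply: F_sup => //.
  - by move=> i; rewrite mulr_ge0 ?subr_ge0.
  - by move=> i; rewrite mulr_ge0 // addr_ge0 // mulr_ge0 // ler0n.
  - by rewrite (meval_homog _ _ F_d) exprMn FA.
  - by rewrite (meval_homog _ _ F_d) exprMn ler_wpM2l // exprn_ge0.
by apply: meval_eq => i; ring.
Qed.

(** Throughout, [F] dominates the linear function [kap * D ^ (D - 1) * t] of [t]
    on the ray from [x] in the direction [e_k], where [D = d.+2] is the degree.
    The constant is chosen so that [kap * (D - 1) ^ (D - 1)] is the bound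
    obtained for the derivative at [x]. *)
Section Descent.
Variables (d : nat) (F : {mpoly R[n]}) (x : 'I_n -> R) (k : 'I_n) (kap : R).
Hypotheses (F_ge0 : nonneg_coeffs F) (F_d : F \is d.+2.-homog).
Hypotheses (F_sup : superadditive d.+2 F).
Hypotheses (x_ge0 : forall i, 0 <= x i) (kap_gt0 : 0 < kap).
Hypothesis F_line : forall t, 0 <= t ->
  kap * d.+2%:R ^+ d.+1 * t <= F.@[fun i => x i + t * delta R k i].

Let D_gt0 : 0 < d.+2%:R :> R. Proof. by rewrite ltr0n. Qed.
Let d_gt0 : 0 < d.+1%:R :> R. Proof. by rewrite ltr0n. Qed.
Let lt_pow : kap * d.+1%:R ^+ d.+1 < kap * d.+2%:R ^+ d.+1.
Proof.
by rewrite ltr_pM2l // ltrXn2r ?nnegrE ?ler0n // ltr_nat.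
Qed.

Lemma descent_from_zero : F.@[x] = 0 -> kap * d.+2%:R ^+ d.+1 <= F^`M(k).@[x].
Proof.
move=> F0; have [u uE] := meval_coord_line F x k.
have at0 G : G.@[fun i => x i + 0 * delta R k i] = G.@[x].
  by apply: meval_eq => i; rewrite mul0r addr0.
have := (uE 0).2; rewrite at0 => <-.
apply: (@horner_deriv0_ge _ _ _ 1) => // t /andP[/ltW t_ge0 _].
by rewrite (uE 0).1 at0 F0 add0r mulrC (uE t).1; apply: F_line.
Qed.

(* If F x = (r (D - 1))^D, the extremal restriction to the ray is
   (r (D - 1 + a t))^D with a = scale r; its ratio to t is least at t = 1 / a. *)
Let scale (r : R) : R := kap / (d.+2%:R * r ^+ d.+2).

Let scale_gt0 (r : R) : 0 < r -> 0 < scale r.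
Proof. by move=> r_gt0; rewrite divr_gt0 // mulr_gt0 // exprn_gt0. Qed.

Let scaleE (r : R) : 0 < r -> kap = d.+2%:R * r ^+ d.+2 * scale r.
Proof.
move=> r_gt0; rewrite mulrC divfK // mulf_neq0 ?lt0r_neq0 // exprn_gt0 //.
Qed.

Let line_scale (r : R) : 0 < r ->
  (r * d.+2%:R) ^+ d.+2 <= F.@[fun i => x i + (scale r)^-1 * delta R k i].
Proof.
move=> r_gt0; have a_gt0 := scale_gt0 r_gt0.
apply: le_trans (F_line _); last by rewrite invr_ge0 ltW.
have := scaleE r_gt0; move: a_gt0; set a := scale r; clearbody a => a_gt0 ->.
rewrite exprMn (exprS d.+2%:R d.+1) [leRHS](_ : _ = r ^+ d.+2 * (d.+2%:R * d.+2%:R ^+ d.+1)) //.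
by field; rewrite lt0r_neq0.
Qed.

(** With [F x = A ^ D] and [A = r (D - 1)], the chord up to the point
    [t = 1 / scale r] gives the best bound: there [F] is at least [(r D) ^ D],
    so the root increases by at least [r]. *)
Lemma capacity_descent : kap * d.+1%:R ^+ d.+1 <= F^`M(k).@[x].
Proof.
have [A A_ge0 FA] := exp_root d.+1 (meval_ge0 F_ge0 x_ge0).
have [A0|A_neq0] := eqVneq A 0.
  apply: le_trans (ltW lt_pow) _; apply: descent_from_zero.
  by rewrite -FA A0 expr0n.
pose r : R := A / d.+1%:R.
have r_gt0 : 0 < r by rewrite divr_gt0 // lt0r A_neq0.
have AE : A = r * d.+1%:R by rewrite divfK // lt0r_neq0.
clearbody r; have a_gt0 := scale_gt0 r_gt0.
have := superadditive_tangent F_d F_sup x_ge0 _ A_ge0 _ FA (line_scale r_gt0).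
rewrite invr_ge0 (ltW a_gt0) mulr_ge0 ?ler0n ?(ltW r_gt0) // => /(_ isT isT).
rewrite ler_pdivlMl // => /(le_trans _); apply.
have := scaleE r_gt0; move: a_gt0; set a := scale r; clearbody a => a_gt0 ->.
rewrite AE -mulrBr -natrB ?leqnSn // subSnn.
rewrite exprMn (exprS r d.+1) -subr_ge0 [X in 0 <= X](_ : _ = 0) //.
by ring.
Qed.

(** When the bound is attained, the tangent at [t = 0] bounds [F] from above by
    the extremal restriction, and the chord up to [t = 1 / a] bounds it from
    below by the same polynomial; two polynomials that agree on an interval are
    equal. *)
Lemma capacity_descent_eq : F^`M(k).@[x] <= kap * d.+1%:R ^+ d.+1 ->
  exists r a, [/\ 0 < r, 0 < a, kap = d.+2%:R * r ^+ d.+2 * a &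
     forall t, F.@[fun i => x i + t * delta R k i]
               = (r * (d.+1%:R + a * t)) ^+ d.+2].
Proof.
move=> G_le.
have [A A_ge0 FA] := exp_root d.+1 (meval_ge0 F_ge0 x_ge0).
have A_gt0 : 0 < A.
  rewrite lt0r A_ge0 andbT; apply: contraTneq lt_pow => A0.
  rewrite -leNgt; apply: le_trans _ G_le; apply: descent_from_zero.
  by rewrite -FA A0 expr0n.
pose r : R := A / d.+1%:R.
have r_gt0 : 0 < r by rewrite divr_gt0.
have AE : A = r * d.+1%:R by rewrite divfK // lt0r_neq0.
clearbody r; have a_gt0 := scale_gt0 r_gt0.
exists r, (scale r); split => //; first exact: scaleE.
have := line_scale r_gt0; have := scaleE r_gt0.
set a := scale r in a_gt0 *; clearbody a => kapE line_a.
have upper (t : R) : 0 <= t -> F.@[fun i => x i + t * delta R k i]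
    <= (r * (d.+1%:R + a * t)) ^+ d.+2.
  move=> t_ge0.
  have xt_ge0 i : 0 <= x i + t * delta R k i by rewrite addr_ge0 // mulr_ge0 // ler0n.
  have [B B_ge0 FB] := exp_root d.+1 (meval_ge0 F_ge0 xt_ge0).
  have FB' : B ^+ d.+2 <= F.@[fun i => x i + t * delta R k i] by rewrite FB.
  have H := superadditive_tangent F_d F_sup x_ge0 t_ge0 A_ge0 B_ge0 FA FB'.
  rewrite -FB.
  apply: lerXn2r; rewrite ?nnegrE //.
    by apply: mulr_ge0; [exact: ltW | rewrite addr_ge0 ?ler0n ?mulr_ge0 // ltW].
  have := le_trans H (ler_wpM2l t_ge0 G_le).
  have -> : t * (kap * d.+1%:R ^+ d.+1) = d.+2%:R * A ^+ d.+1 * (r * (a * t)).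
    by rewrite kapE AE exprMn (exprS r d.+1); ring.
  rewrite ler_pM2l ?mulr_gt0 ?exprn_gt0 //; rewrite AE; lra.
have lower (t : R) : 0 <= t -> a * t <= 1 ->
    (r * (d.+1%:R + a * t)) ^+ d.+2 <= F.@[fun i => x i + t * delta R k i].
  move=> t_ge0; set s := a * t => s_le1.
  have s_ge0 : 0 <= s by rewrite mulr_ge0 // ltW.
  rewrite [leRHS](_ : _ = F.@[fun i => (1 - s) * x i + s * (x i + a^-1 * delta R k i)]).
    rewrite [in leLHS](_ : r * _ = (1 - s) * A + s * (r * d.+2%:R)); last first.
      by rewrite AE -(natr1 d.+1); ring.
    apply: F_sup => //.
    - by move=> i; rewrite mulr_ge0 ?subr_ge0.
    - by move=> i; rewrite mulr_ge0 // addr_ge0 // mulr_ge0 ?ler0n // invr_ge0 ltW.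
    - by rewrite mulr_ge0 // subr_ge0.
    - by rewrite !mulr_ge0 ?ler0n // ltW.
    - by rewrite (meval_homog _ _ F_d) exprMn FA.
    - rewrite (meval_homog _ _ F_d) exprMn ler_wpM2l ?exprn_ge0 //.
  by apply: meval_eq => i; rewrite /s; field; rewrite lt0r_neq0.
have [u uE] := meval_coord_line F x k.
pose w : {poly R} := (r *: (d.+1%:R%:P + a *: 'X)) ^+ d.+2.
have wE t : w.[t] = (r * (d.+1%:R + a * t)) ^+ d.+2 by rewrite horner_exp !hornerE.
have uw : u = w.
  apply: (@poly_eq_itv _ _ _ a^-1); first by rewrite invr_gt0.
  move=> t /andP[/ltW t_ge0 t_le]; rewrite (uE t).1 wE; apply/eqP.
  by rewrite eq_le upper //= lower // mulrC -ler_pdivlMr // div1r.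
by move=> t; rewrite -(uE t).1 uw wE.
Qed.

End Descent.
End Tangent.

(** * Faces of the orthant *)

Section Cone.
Variables (R : realType) (n : nat).
Implicit Types (F G H : {mpoly R[n]}) (x y b : 'I_n -> R) (S : {set 'I_n}).
Implicit Types (m : 'X_{1..n}).

Definition cone S x :=
  (forall i, 0 <= x i) /\ (forall i, i \notin S -> x i = 0).

Definition supported S m := forall i, i \notin S -> m i = 0%N.

Definition linform b S : {mpoly R[n]} := \sum_(i in S) b i *: 'X_i.

Lemma coneD S x y : cone S x -> cone S y -> cone S (fun i => x i + y i).
Proof.
move=> [x_ge0 xS] [y_ge0 yS]; split=> i; first by rewrite addr_ge0.
by move=> iS; rewrite xS // yS // addr0.
Qed.

Lemma coneZ S x (t : R) : 0 <= t -> cone S x -> cone S (fun i => t * x i).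
Proof.
move=> t_ge0 [x_ge0 xS]; split=> i; first by rewrite mulr_ge0.
by move=> iS; rewrite xS // mulr0.
Qed.

Lemma cone_delta S k : k \in S -> cone S (delta R k).
Proof.
move=> kS; split=> i; first by rewrite ler0n.
by rewrite /delta; case: eqP => // ->; rewrite kS.
Qed.

Lemma coneS (S T : {set 'I_n}) x : S \subset T -> cone S x -> cone T x.
Proof.
move=> /fintype.subsetP ST [x_ge0 xS]; split=> // i iT; apply: xS.
by apply: contra iT; apply: ST.
Qed.

Lemma meval_linform b S x : (linform b S).@[x] = \sum_(i in S) b i * x i.
Proof.
by rewrite raddf_sum /=; apply: eq_bigr => i _; rewrite mevalZ mevalXU.
Qed.

Lemma linform_coord b S k : k \in S -> (linform b S).@[delta R k] = b k.
Proof.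
move=> kS; rewrite meval_linform (bigD1 k) //= /delta eqxx mulr1.
by rewrite big1 ?addr0 // => i /andP[_ /negPf ->]; rewrite mulr0.
Qed.

Lemma mevalXn_linform b S x d :
  ((linform b S) ^+ d).@[x] = (\sum_(i in S) b i * x i) ^+ d.
Proof. by rewrite rmorphXn /= meval_linform. Qed.

Lemma linform_exp_homog b S d : linform b S ^+ d \is d.-homog.
Proof.
rewrite -[in X in X.-homog](mul1n d); apply: dhomogMn; apply: rpred_sum => j _.
by apply: dhomogZ; rewrite dhomogX /= mdeg1.
Qed.

Lemma mderiv_linform b S k : k \in S -> (linform b S)^`M(k) = (b k)%:MP.
Proof.
move=> kS; rewrite raddf_sum (bigD1 k) //= big1 => [|i /andP[_ /negPf ik]].
  rewrite addr0 mderivZ mderivX mnm1E eqxx scale1r.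
  rewrite -[X in (X - _)%MM]addm0 addmC addmK mpolyX0.
  by rewrite -mul_mpolyC mulr1.
by rewrite mderivZ mderivX mnm1E ik scale0r scaler0.
Qed.

Lemma mderiv_exp F d k : (F ^+ d.+1)^`M(k) = d.+1%:R *: (F ^+ d * F^`M(k)).
Proof.
elim: d => [|d IHd]; first by rewrite expr1 expr0 mul1r scale1r.
rewrite exprS mderivM IHd -(natr1 d.+1) scalerDl scale1r -scalerAr mulrA -exprS.
by rewrite addrC [F^`M(k) * _]mulrC.
Qed.

Lemma mderiv_linform_exp b S k d : k \in S ->
  (linform b S ^+ d.+1)^`M(k) = (d.+1%:R * b k) *: linform b S ^+ d.
Proof.
by move=> kS; rewrite mderiv_exp mderiv_linform // mulrC mul_mpolyC scalerA.
Qed.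

Lemma mnm_neq0P m : m != 0%MM -> exists i m', m = (U_(i) + m')%MM.
Proof.
move=> m_neq0; have [i mi] : exists i, m i != 0%N.
  apply/existsP; apply: contraNT m_neq0 => /existsPn m0; apply/eqP/mnmP => i.
  by rewrite mnm0E; have := m0 i; rewrite negbK => /eqP.
exists i, (m - U_(i))%MM; rewrite addmC submK //; apply/mnm_lepP => j.
by rewrite mnm1E; case: eqP => //= <-; rewrite lt0n.
Qed.

(** Lets iterated derivatives be handled one variable of [S] at a time. *)
Lemma mnm_supported_ind S (P : 'X_{1..n} -> Prop) : P 0%MM ->
  (forall i m, i \in S -> supported S m -> P m -> P (U_(i) + m)%MM) ->
  forall m, supported S m -> P m.
Proof.
move=> P0 PS m; have [e] := ubnP (mdeg m); elim: e m => // e IHe m.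
have [->//|/mnm_neq0P[i [m' ->]]] := eqVneq m 0%MM.
rewrite mdegD mdeg1 add1n ltnS => m'e mS.
have iS : i \in S.
  by apply: contraT => /mS; rewrite mnmDE mnm1E eqxx.
have m'S : supported S m'.
  by move=> j /mS; rewrite mnmDE => /eqP; rewrite addn_eq0 => /andP[_ /eqP].
by apply: PS => //; apply: IHe.
Qed.

Lemma linform_exp_mderivm b S m e : (forall i, i \in S -> 0 < b i) ->
  supported S m -> exists2 K : R, 0 < K &
  (linform b S ^+ (mdeg m + e))^`M[m] = K *: linform b S ^+ e.
Proof.
move=> b_gt0 mS; elim/(mnm_supported_ind (S := S)): m / mS => [|i m iS mS [K K_gt0 KE]].
  by exists 1 => //; rewrite mdeg0 mderivm0m scale1r.
exists ((mdeg m + e).+1%:R * b i * K); first by rewrite !mulr_gt0 ?b_gt0 // ltr0Sn.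
rewrite mdegD mdeg1 add1n addSn mderivmDm mderivmU1m mderiv_linform_exp //.
by rewrite mderivmZ KE scalerA.
Qed.

Lemma mderiv_cone_eq0 S H i : i \in S -> (forall x, cone S x -> H.@[x] = 0) ->
  forall x, cone S x -> H^`M(i).@[x] = 0.
Proof.
move=> iS H0 x xS; have [u uE] := meval_coord_line H x i.
have u0 : u = 0.
  apply: (@poly_eq0_itv _ _ 1) => // t /andP[/ltW t_ge0 _]; rewrite (uE t).1.
  by apply: H0; apply: coneD => //; apply: coneZ => //; apply: cone_delta.
have := (uE 0).2; rewrite u0 deriv0 horner0 => ->.
by apply: meval_eq => j; rewrite mul0r addr0.
Qed.

Lemma mderivm_cone_eq0 S H m : supported S m ->
  (forall x, cone S x -> H.@[x] = 0) -> forall x, cone S x -> H^`M[m].@[x] = 0.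
Proof.
move=> mS; move: H; elim/(mnm_supported_ind (S := S)): m / mS => [|i m iS _ IH] H H0.
  by rewrite mderivm0m.
by rewrite mderivmDm mderivmU1m; apply: IH; apply: mderiv_cone_eq0.
Qed.

Lemma meval_at0 F : F.@[fun=> 0] = F@_0%MM.
Proof.
rewrite mevalE [in RHS](mpolyE F) raddf_sum; apply: eq_bigr => m _ /=.
rewrite mcoeffZ mcoeffX; congr (_ * _).
have [->|/mnm_neq0P[i [m' ->]]] := eqVneq.
  by rewrite big1 // => i _; rewrite mnm0E expr0.
by rewrite (bigD1 i) //= mnmDE mnm1E eqxx expr0n mul0r.
Qed.

(** All derivatives in the directions of [S] vanish on the face too, and at the
    origin they are the coefficients up to factorials. *)
Lemma mcoeff_cone_eq0 S H m : supported S m ->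
  (forall x, cone S x -> H.@[x] = 0) -> H@_m = 0.
Proof.
move=> mS H0; have := mderivm_cone_eq0 mS H0 (x := fun=> 0).
rewrite meval_at0 mcoeff_mderivm addm0 => /(_ _)/eqP.
rewrite mulrn_eq0 => /(_ _)/orP[]; first by split.
  by rewrite -leqn0 leqNgt prodn_gt0 // => i; rewrite ffact_gt0.
by move=> /eqP.
Qed.

(** The [d.+1]-th root of [G] minus the linear form is concave, nonnegative on
    the face and zero at the relative interior point [y], hence zero: write a
    multiple of [y] as [x + z] with [z] in the face and use superadditivity. *)
Lemma superadditive_touching d G S b y :
  nonneg_coeffs G -> G \is d.+1.-homog -> superadditive d.+1 G ->
  (forall i, i \in S -> 0 <= b i) ->
  (forall x, cone S x -> (linform b S ^+ d.+1).@[x] <= G.@[x]) ->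
  cone S y -> (forall i, i \in S -> 0 < y i) ->
  G.@[y] <= (linform b S ^+ d.+1).@[y] ->
  forall x, cone S x -> G.@[x] = (linform b S ^+ d.+1).@[x].
Proof.
move=> G_ge0 G_d G_sup b_ge0 lb yS y_gt0 Gy x xS; apply/eqP.
rewrite eq_le lb // andbT.
have lin_ge0 z : cone S z -> 0 <= \sum_(i in S) b i * z i.
  by move=> [z_ge0 _]; apply: sumr_ge0 => i iS; rewrite mulr_ge0 ?b_ge0.
have [c c_ge0 Gc] := exp_root d (meval_ge0 G_ge0 xS.1).
(* Large enough for M y - x to stay in the face. *)
pose M : R := \sum_(i in S) x i / y i.
have quo_ge0 i : i \in S -> 0 <= x i / y i.
  by move=> iS; rewrite divr_ge0 ?xS.1 // ltW // y_gt0.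
have M_ge0 : 0 <= M by apply: sumr_ge0.
pose z i := M * y i - x i.
have zS : cone S z.
  split=> i; last by move=> iS; rewrite /z xS.2 // yS.2 // mulr0 subr0.
  have [iS|iS] := boolP (i \in S); last by rewrite /z xS.2 // yS.2 // mulr0 subr0.
  rewrite subr_ge0 -ler_pdivrMr ?y_gt0 // /M (bigD1 i) //= lerDl.
  by apply: sumr_ge0 => j /andP[jS _]; apply: quo_ge0.
have lbz := lb z zS; rewrite mevalXn_linform in lbz.
have := G_sup x z c _ xS.1 zS.1 c_ge0 (lin_ge0 z zS) _ lbz.
rewrite Gc lexx => /(_ isT).
have -> : G.@[fun i => x i + z i] = G.@[fun i => M * y i].
  by apply: meval_eq => i; rewrite /z; ring.
rewrite (meval_homog _ _ G_d) => /le_trans/(_ (ler_wpM2l (exprn_ge0 _ M_ge0) Gy)).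
rewrite !mevalXn_linform -exprMn -Gc.
rewrite ler_pXn2r // ?nnegrE ?addr_ge0 ?mulr_ge0 ?lin_ge0 // => H.
apply: lerXn2r; rewrite ?nnegrE ?lin_ge0 //.
have : \sum_(i in S) b i * z i
    = M * \sum_(i in S) b i * y i - \sum_(i in S) b i * x i.
  by rewrite mulr_sumr -sumrB; apply: eq_bigr => i _; rewrite /z; ring.
by move: H => /[swap] ->; lra.
Qed.

End Cone.

(** * Powers of linear forms are determined by one partial derivative *)

Section Rigidity.
Variables (R : realType) (n : nat).
Implicit Types (F G H : {mpoly R[n]}) (x y b : 'I_n -> R) (S : {set 'I_n}).
Implicit Types (m : 'X_{1..n}).

Lemma poly_deriv_eq0 (u : {poly R}) : u^`() = 0 -> u = u.[0]%:P.
Proof.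
move=> u'0; apply/polyP => -[|i]; rewrite coefC /= ?horner_coef0 //.
have := coef_deriv u i; rewrite u'0 coef0 => /esym/eqP.
by rewrite mulrn_eq0 => /eqP.
Qed.

Lemma meval_delta d F i : F \is d.-homog -> F.@[delta R i] = F@_(U_(i) *+ d)%MM.
Proof.
move=> /dhomogP F_d; rewrite mevalE [in RHS](mpolyE F) raddf_sum /=.
apply: eq_big_seq => m /F_d /= md; rewrite mcoeffZ mcoeffX; congr (_ * _).
have [->|m_neq] := eqVneq.
  rewrite big1 // => j _; rewrite /delta mulmnE mnm1E eq_sym.
  by case: eqP => _; rewrite ?expr1n // mul0n expr0.
have [j /andP[ji mj]] : exists j, (j != i) && (m j != 0%N).
  apply/existsP; apply: contraNT m_neq => /existsPn m0; apply/eqP.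
  have m0' j : j != i -> m j = 0%N.
    by move=> ji; have := m0 j; rewrite ji negbK => /eqP.
  have mi : m i = d.
    by rewrite -md [mdeg m]mdegE (bigD1 i) //= big1 ?addn0 // => j /m0'.
  apply/mnmP => j; rewrite mulmnE mnm1E eq_sym; case: eqVneq => [->|/m0' ->].
    by rewrite mul1n.
  by rewrite mul0n.
by rewrite (bigD1 j) //= /delta (negPf ji) expr0n (negPf mj) mul0r.
Qed.

Lemma cone_const_along H S k x : k \in S -> cone S x ->
  (forall z, cone S z -> H^`M(k).@[z] = 0) ->
  H.@[fun i => x i + delta R k i] = H.@[x].
Proof.
move=> kS xS H'0; have [u uE] := meval_coord_line H x k.
have /poly_deriv_eq0 u_const : u^`() = 0.
  apply: (@poly_eq0_itv _ _ 1) => // t /andP[/ltW t_ge0 _]; rewrite (uE t).2.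
  by apply: H'0; apply: coneD => //; apply: coneZ => //; apply: cone_delta.
have -> : H.@[x] = u.[0].
  by rewrite (uE 0).1; apply: meval_eq => j; rewrite mul0r addr0.
have -> : H.@[fun i => x i + delta R k i] = u.[1].
  by rewrite (uE 1).1; apply: meval_eq => j; rewrite mul1r.
by rewrite {1}u_const hornerC.
Qed.

(** Differentiating [m] times leaves two quadratic forms which differ by a
    form [E^`M[m]] that does not depend on [x_k].  That of the power is, up to a
    positive factor, the square of the linear form, so in the variables [i], [k]
    only the coefficient of [x_i ^ 2] may differ; superadditivity of the other
    one says that its discriminant is nonnegative, which forces the coefficient
    of [x_i ^ 2] not to exceed the one of the square. *)
Lemma mcoeff_le_linform_exp d F S k b i m : completely_superadditive d.+2 F ->
  k \in S -> i \in S -> (forall j, j \in S -> 0 < b j) ->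
  (forall x, cone S x -> F^`M(k).@[x] = (linform b S ^+ d.+2)^`M(k).@[x]) ->
  supported S m -> mdeg m = d ->
  F@_(m + U_(i) *+ 2)%MM <= (linform b S ^+ d.+2)@_(m + U_(i) *+ 2)%MM.
Proof.
move=> [F_ge0 F_d F_sup] kS iS b_gt0 F'E mS md.
set P := linform b S ^+ d.+2; pose E := F - P.
have E_d : E \is d.+2.-homog by rewrite rpredB // linform_exp_homog.
have Em_d : E^`M[m] \is 2.-homog by apply: mderivm_homog; rewrite md addn2.
have Em_k x : cone S x -> E^`M[m]^`M(k).@[x] = 0.
  rewrite -mderivmU1m -mderivmDm addmC mderivmDm mderivmU1m.
  apply: mderivm_cone_eq0 => // z zS.
  by rewrite mderivB mevalB F'E // subrr.
rewrite -subr_le0 -mcoeffB -/E.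
suff : E^`M[m].@[delta R i] <= 0.
  rewrite (meval_delta _ Em_d) mcoeff_mderivm.
  rewrite pmulrn_lle0 //.
  by apply: prodn_gt0 => j; rewrite ffact_gt0 mnmDE leq_addr.
have [K K_gt0 PK] := linform_exp_mderivm 2 b_gt0 mS.
rewrite md addn2 -/P in PK.
have [q q_ge0 qK] := exp_root 1 (ltW K_gt0).
have q_gt0 : 0 < q.
  by rewrite lt0r q_ge0 andbT; apply: contraTneq K_gt0 => q0; rewrite -qK q0 expr0n ltxx.
have Fm x : F^`M[m].@[x] = (q * \sum_(j in S) b j * x j) ^+ 2 + E^`M[m].@[x].
  rewrite /E mderivmB PK mevalB mevalZ mevalXn_linform -qK exprMn; ring.
have coord j : j \in S -> \sum_(l in S) b l * delta R j l = b j.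
  by move=> jS; rewrite -meval_linform linform_coord.
have iC := cone_delta R iS; have kC := cone_delta R kS.
have Ek : E^`M[m].@[delta R k] = 0.
  have C0 : cone S (fun j => 0 * delta R k j) by apply: coneZ.
  have := cone_const_along kS C0 Em_k; rewrite (meval_homog _ _ Em_d) expr0n mul0r => <-.
  by apply: meval_eq => j; rewrite mul0r add0r.
have [c c_ge0 cE] := exp_root 1 (meval_ge0 (mderivm_ge0 m F_ge0) iC.1).
have qb_ge0 : 0 <= q * b k by rewrite mulr_ge0 // ltW // b_gt0.
have := F_sup m 2 _ _ _ _ _ iC.1 kC.1 c_ge0 qb_ge0.
rewrite md addn2 cE lexx {1}Fm coord // Ek addr0 lexx => /(_ erefl isT isT).
rewrite Fm (cone_const_along kS iC Em_k).
rewrite (eq_bigr (fun l => b l * delta R i l + b l * delta R k l)); last first.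
  by move=> l _; rewrite mulrDr.
rewrite big_split /= !coord //.
move: cE; rewrite Fm coord //; set e := E^`M[m].@[_] => cE H.
have bi_gt0 := b_gt0 i iS; have bk_gt0 := b_gt0 k kS.
(* Only the cross terms 2 c q b_k and 2 q^2 b_i b_k remain in H. *)
have : c <= q * b i.
  rewrite -(ler_pM2r (mulr_gt0 q_gt0 bk_gt0)); nra.
move=> c_le; have := lerXn2r 2 _ _ c_le.
rewrite !nnegrE c_ge0 mulr_ge0 ?(ltW bi_gt0) // => /(_ isT isT).
by rewrite cE; lra.
Qed.

(** No coefficient of [F] exceeds the one of the power: either the monomial
    involves [x_k], and then the coefficients agree by the hypothesis on the
    derivative, or it has degree [#|S|] in fewer than [#|S|] variables, and then
    some variable occurs at least twice.  Equality of the values at a point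
    with positive coordinates excludes any strict inequality. *)
Lemma eq_linform_exp d F S k b y : completely_superadditive d.+2 F ->
  #|S| = d.+2 -> k \in S -> (forall j, j \in S -> 0 < b j) ->
  (forall x, cone S x -> F^`M(k).@[x] = (linform b S ^+ d.+2)^`M(k).@[x]) ->
  cone S y -> (forall i, i \in S -> 0 < y i) ->
  F.@[y] = (linform b S ^+ d.+2).@[y] ->
  forall x, cone S x -> F.@[x] = (linform b S ^+ d.+2).@[x].
Proof.
move=> F_cs cardS kS b_gt0 F'E yS y_gt0 Fy x xS; have [_ F_d _] := F_cs.
set P := linform b S ^+ d.+2; pose E := F - P.
have E_d : E \is d.+2.-homog by rewrite rpredB // linform_exp_homog.
have E_le0 m : supported S m -> mdeg m = d.+2 -> E@_m <= 0.
  move=> mS md; have [mk0|mk_neq0] := eqVneq (m k) 0%N; last first.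
    have mE : m = (m - U_(k) + U_(k))%MM.
      rewrite submK //; apply/mnm_lepP => j; rewrite mnm1E.
      by case: eqP => //= <-; rewrite lt0n.
    have : E^`M(k)@_(m - U_(k))%MM = 0.
      apply: (mcoeff_cone_eq0 (S := S)) => [j /mS jm|z zS].
        by rewrite mnmBE jm.
      by rewrite mderivB mevalB F'E // subrr.
    move=> /eqP; rewrite mcoeff_mderiv -mE mulrn_eq0 /= => /eqP ->.
    by rewrite lexx.
  have [i /andP[iS mi]] : exists i, (i \in S) && (1 < m i)%N.
    apply/existsP; apply: contraPT md => /existsPn m_le1; apply/eqP.
    rewrite neq_ltn; apply/orP; left; rewrite mdegE.
    rewrite (bigID (mem (S :\ k))) /= [X in (_ + X)%N]big1 => [|j]; last first.
      by rewrite in_setD1 negb_and negbK => /orP[/eqP ->//|/mS].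
    rewrite addn0 -cardS (cardsD1 k) kS add1n ltnS -sum1_card.
    apply: leq_sum => j; rewrite in_setD1 => /andP[_ jS].
    by have := m_le1 j; rewrite jS /= -leqNgt.
  pose m' := (m - U_(i) *+ 2)%MM.
  have mE : m = (m' + U_(i) *+ 2)%MM.
    rewrite submK //; apply/mnm_lepP => j; rewrite mulmnE mnm1E.
    by case: eqP => [<-|//].
  have m'S : supported S m' by move=> j /mS jm; rewrite mnmBE jm.
  rewrite mE mcoeffB subr_le0.
  apply: (mcoeff_le_linform_exp (k := k)) => //.
  by move: md; rewrite {1}mE mdegD mdegMn mdeg1 mul1n addn2 => -[].
have E_eq0 m : m \in msupp E -> supported S m -> E@_m = 0.
  move=> mE mS.
  have supp_md z : z \in msupp E -> mdeg z = d.+2 by move/dhomogP: E_d; apply.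
  have y_pow z : 0 <= \prod_i y i ^+ z i.
    by apply: prodr_ge0 => i _; rewrite exprn_ge0 // yS.1.
  have term_ge0 z : z \in msupp E -> 0 <= - (E@_z * \prod_i y i ^+ (z : 'X_{1..n}) i).
    move=> zE; rewrite -mulNr.
    have [zS|] := pselect (supported S z).
      by rewrite mulr_ge0 ?y_pow // oppr_ge0 E_le0 // supp_md.
    move=> /existsNP[j /not_implyP[jS zj]].
    rewrite (bigD1 j) //= yS.2 // expr0n; move/eqP: zj => /negPf ->.
    by rewrite mul0r mulr0.
  have /eqP : \sum_(z <- msupp E) - (E@_z * \prod_i y i ^+ (z : 'X_{1..n}) i) = 0.
    by rewrite sumrN -mevalE mevalB Fy subrr oppr0.
  rewrite big_seq psumr_eq0 // => /allP/(_ m mE); rewrite mE /= oppr_eq0.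
  rewrite mulf_eq0 => /orP[/eqP//|]; apply: contraTeq => _.
  rewrite prodf_seq_neq0; apply/allP => j _ /=.
  have [jS|/mS ->] := boolP (j \in S); last by rewrite expr0 oner_neq0.
  by rewrite expf_neq0 // lt0r_neq0 // y_gt0.
apply/eqP; rewrite -subr_eq0 -mevalB -/E mevalE big_seq; apply/eqP.
apply: big1 => m mE; have [mS|] := pselect (supported S m).
  by rewrite E_eq0 ?mul0r.
move=> /existsNP[j /not_implyP[jS mj]].
rewrite (bigD1 j) //= xS.2 // expr0n; move/eqP: mj => /negPf ->.
by rewrite mul0r mulr0.
Qed.

End Rigidity.

(** * The capacity inequality and its equality case *)

Section Capacity.
Variables (R : realType) (n : nat).
Implicit Types (F G : {mpoly R[n]}) (x y b : 'I_n -> R) (S : {set 'I_n}).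

Definition indicator S : 'X_{1..n} := [multinom (i \in S : nat) | i < n].

Lemma indicatorD1 S k : k \in S ->
  indicator S = (U_(k) + indicator (S :\ k))%MM.
Proof.
move=> kS; apply/mnmP => i; rewrite mnmDE mnm1E !mnmE in_setD1 eq_sym.
by case: eqVneq => [->|]; rewrite ?kS.
Qed.

Definition capacity_ge S F (C : R) :=
  forall x, cone S x -> C * \prod_(i in S) x i <= F.@[x].

Lemma cone_line S k x (t : R) : k \in S -> cone (S :\ k) x -> 0 <= t ->
  cone S (fun i => x i + t * delta R k i).
Proof.
move=> kS xS t_ge0; apply: coneD; first exact: coneS (subD1set _ _) xS.
by apply: coneZ => //; apply: cone_delta.
Qed.

Lemma prod_line S k x (t : R) : k \in S -> cone (S :\ k) x ->
  \prod_(i in S) (x i + t * delta R k i) = t * \prod_(i in S :\ k) x i.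
Proof.
move=> kS [_ x0]; rewrite (big_setD1 k kS) /= x0 ?setD11 // add0r /delta eqxx mulr1.
congr (_ * _); apply: eq_bigr => i; rewrite in_setD1 => /andP[/negPf -> _].
by rewrite mulr0 addr0.
Qed.

Lemma capacity_ge_deriv d F S k C : completely_superadditive d.+2 F ->
  k \in S -> 0 < C -> capacity_ge S F C ->
  capacity_ge (S :\ k) F^`M(k) (C / d.+2%:R ^+ d.+1 * d.+1%:R ^+ d.+1).
Proof.
move=> F_cs kS C_gt0 F_cap x xS.
have [F_ge0 F_d _] := F_cs.
have [G_ge0 _ _] := completely_superadditive_deriv k F_cs.
have D_gt0 : 0 < d.+2%:R ^+ d.+1 :> R by rewrite exprn_gt0 // ltr0n.
set X := \prod_(i in _) x i.
have X_ge0 : 0 <= X by apply: prodr_ge0 => i _; apply: xS.1.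
have [->|X_neq0] := eqVneq X 0; first by rewrite mulr0 meval_ge0 // => i; apply: xS.1.
have X_gt0 : 0 < X by rewrite lt0r X_neq0.
rewrite [leLHS](_ : _ = C / d.+2%:R ^+ d.+1 * X * d.+1%:R ^+ d.+1); last by ring.
have F_sup2 := completely_superadditive_self F_cs.
apply: capacity_descent => //; first exact: xS.1.
  by rewrite mulr_gt0 // divr_gt0.
move=> t t_ge0; have := F_cap _ (cone_line kS xS t_ge0).
rewrite (prod_line t kS xS) -/X; apply: le_trans.
move: D_gt0; set P := _ ^+ d.+1 => P_gt0.
by rewrite [leLHS](_ : _ = C * (t * X)) //; field; rewrite lt0r_neq0.
Qed.

Lemma linform_extend (g : 'I_n -> R) (a : R) S k x : k \in S -> 
  \sum_(i in S) (if i == k then a else g i) * x i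
  = \sum_(i in S :\ k) g i * x i + a * x k.
Proof.
move=> kS; rewrite (big_setD1 k kS) /= eqxx addrC; congr (_ + _).
by apply: eq_bigr => i; rewrite in_setD1 => /andP[/negPf ->].
Qed.

(** [F^`M(k)] is known on the face [x_k = 0].  At the minimizer [x0 = 1 / g]
    of its capacity the descent is tight, so [F] is known on the ray from [x0] in
    the direction [e_k], and with it [F^`M(k)] on that ray and, by homogeneity,
    at [e_k].  Superadditivity bounds [F^`M(k)] from below by a power of a linear
    form, which it touches on the ray; hence [F^`M(k)] is that power, and [F] is
    determined by it. *)
Lemma equality_step d F S k C g : completely_superadditive d.+2 F ->
  #|S| = d.+2 -> k \in S -> 0 < C -> capacity_ge S F C ->
  (forall i, i \in S :\ k -> 0 < g i) ->
  (forall x, cone (S :\ k) x ->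
     F^`M(k).@[x] = (linform g (S :\ k) ^+ d.+1).@[x]) ->
  d.+2%:R ^+ d.+1 * \prod_(i in S :\ k) g i = C ->
  exists b, [/\ forall i, i \in S -> 0 < b i,
    forall x, cone S x -> F.@[x] = (linform b S ^+ d.+2).@[x] &
    d.+2%:R ^+ d.+2 * \prod_(i in S) b i = C].
Proof.
move=> F_cs cardS kS C_gt0 F_cap g_gt0 GE CE.
have [F_ge0 F_d _] := F_cs.
have F_sup2 := completely_superadditive_self F_cs.
have G_cs := completely_superadditive_deriv k F_cs.
have [G_ge0 G_d _] := G_cs.
have G_sup1 := completely_superadditive_self G_cs.
have cardS' : #|S :\ k| = d.+1 by move: cardS; rewrite (cardsD1 k) kS add1n => -[].
pose x0 i := if i \in S :\ k then (g i)^-1 else 0.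
have x0S : cone (S :\ k) x0.
  split=> i; rewrite /x0; last by move/negPf ->.
  by case: ifP => // iS; rewrite invr_ge0 ltW // g_gt0.
have x0k : x0 k = 0 by rewrite /x0 setD11.
have gx0 : \sum_(i in S :\ k) g i * x0 i = d.+1%:R.
  rewrite (eq_bigr (fun=> 1)) => [|i iS]; first by rewrite sumr_const cardS'.
  by rewrite /x0 iS divff // lt0r_neq0 // g_gt0.
have Gx0 : F^`M(k).@[x0] = d.+1%:R ^+ d.+1 by rewrite GE // mevalXn_linform gx0.
have F_line t : 0 <= t ->
    1 * d.+2%:R ^+ d.+1 * t <= F.@[fun i => x0 i + t * delta R k i].
  move=> t_ge0; apply: le_trans (F_cap _ (cone_line kS x0S t_ge0)).
  rewrite (prod_line t kS x0S) -CE mul1r.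
  have -> : \prod_(i in S :\ k) x0 i = (\prod_(i in S :\ k) g i)^-1.
    by rewrite -prodfV; apply: eq_bigr => i iS; rewrite /x0 iS.
  rewrite mulrC mulrCA mulfK //.
  by rewrite prodf_seq_neq0; apply/allP => i _; apply/implyP => iS; rewrite lt0r_neq0 // g_gt0.
have [|r [a [r_gt0 a_gt0 ra F_lineE]]] :=
    capacity_descent_eq F_ge0 F_d F_sup2 x0S.1 ltr01 F_line.
  by rewrite Gx0 mul1r.
have G_lineE t : F^`M(k).@[fun i => x0 i + t * delta R k i]
    = (d.+1%:R + a * t) ^+ d.+1.
  have [u uE] := meval_coord_line F x0 k.
  have -> : F^`M(k).@[fun i => x0 i + t * delta R k i] = u^`().[t] by rewrite (uE t).2.
  have -> : u = (r *: (d.+1%:R%:P + a *: 'X)) ^+ d.+2.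
    apply: (@poly_eq_itv _ _ _ 1) => // s _.
    by rewrite (uE s).1 F_lineE horner_exp !hornerE.
  rewrite deriv_exp derivZ derivD derivZ derivC derivX add0r hornerMn hornerM horner_exp.
  rewrite !hornerE /= -[RHS]mul1r [X in _ = X * _]ra exprMn.
  by rewrite (exprS r d.+1) -mulr_natl; ring.
(* By homogeneity this is the leading coefficient of G_lineE; e_k is reached as
   the limit of e_k + s x0 when s tends to 0. *)
have Gk : F^`M(k).@[delta R k] = a ^+ d.+1.
  have [u uE] := meval_line F^`M(k) (delta R k) x0.
  have uP : u = (a%:P + d.+1%:R *: 'X) ^+ d.+1.
    apply: (@poly_eq_itv _ _ _ 1) => // s /andP[s_gt0 _].
    rewrite (uE s).1 horner_exp !hornerE.
    have -> : F^`M(k).@[fun i => delta R k i + s * x0 i]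
        = F^`M(k).@[fun i => s * (x0 i + s^-1 * delta R k i)].
      by apply: meval_eq => i; field; rewrite lt0r_neq0.
    rewrite (meval_homog _ _ G_d) G_lineE -exprMn; congr (_ ^+ _).
    by field; rewrite lt0r_neq0.
  have := (uE 0).1; rewrite uP horner_exp !hornerE => ->.
  by apply: meval_eq => i; rewrite mul0r addr0.
pose h i := if i == k then a else g i.
have h_gt0 i : i \in S -> 0 < h i.
  by move=> iS; rewrite /h; case: eqVneq => // ik; rewrite g_gt0 // in_setD1 ik.
have hE x : \sum_(i in S) h i * x i = \sum_(i in S :\ k) g i * x i + a * x k.
  exact: linform_extend.
(* The minimizer of the capacity of F. *)
pose y i := x0 i + a^-1 * delta R k i.
have yS : cone S y by apply: cone_line; rewrite // invr_ge0 ltW.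
have y_gt0 i : i \in S -> 0 < y i.
  move=> iS; rewrite /y /delta; case: eqVneq => [->|ik].
    by rewrite x0k add0r mulr1 invr_gt0.
  by rewrite mulr0 addr0 /x0 in_setD1 ik iS invr_gt0 g_gt0 // in_setD1 ik.
have hy : \sum_(i in S) h i * y i = d.+2%:R.
  rewrite hE /y x0k add0r /delta eqxx mulr1 divff ?lt0r_neq0 //.
  rewrite (eq_bigr (fun i => g i * x0 i)) => [|i]; first by rewrite gx0 natr1.
  by rewrite in_setD1 => /andP[/negPf -> _]; rewrite mulr0 addr0.
have G_lb x : cone S x -> (linform h S ^+ d.+1).@[x] <= F^`M(k).@[x].
  move=> [x_ge0 xS]; rewrite mevalXn_linform hE.
  pose x' i := if i == k then 0 else x i.
  have x'S : cone (S :\ k) x'.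
    split=> i; rewrite /x'; first by case: eqP.
    by rewrite in_setD1; case: eqP => //= _ /xS.
  have -> : \sum_(i in S :\ k) g i * x i = \sum_(i in S :\ k) g i * x' i.
    apply: eq_bigr => i; rewrite in_setD1 => /andP[ik _].
    by rewrite /x' (negPf ik).
  have -> : F^`M(k).@[x] = F^`M(k).@[fun i => x' i + x k * delta R k i].
    apply: meval_eq => i; rewrite /x' /delta; case: eqVneq => [->|_].
      by rewrite add0r mulr1.
    by rewrite mulr0 addr0.
  apply: G_sup1.
  - exact: x'S.1.
  - by move=> i; rewrite mulr_ge0 // ler0n.
  - by apply: sumr_ge0 => i iS; rewrite mulr_ge0 ?x'S.1 // ltW // g_gt0.
  - by rewrite mulr_ge0 // ltW.
  - by rewrite GE // mevalXn_linform.
  - by rewrite (meval_homog _ _ G_d) Gk exprMn mulrC.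
have G_full x : cone S x -> F^`M(k).@[x] = (linform h S ^+ d.+1).@[x].
  apply: (superadditive_touching G_ge0 G_d G_sup1 _ G_lb yS y_gt0).
    by move=> i /h_gt0/ltW.
  by rewrite G_lineE mevalXn_linform hy divff ?lt0r_neq0 // natr1.
pose b i := r * h i.
have b_gt0 i : i \in S -> 0 < b i by move=> iS; rewrite mulr_gt0 // h_gt0.
have bE : linform b S = r *: linform h S.
  by rewrite /linform scaler_sumr; apply: eq_bigr => i _; rewrite scalerA.
have rD : d.+2%:R * b k * r ^+ d.+1 = 1.
  by rewrite [RHS]ra /b /h eqxx (exprS r d.+1); ring.
exists b; split=> //.
- apply: (eq_linform_exp F_cs cardS kS b_gt0 _ yS y_gt0) => [x xS|].
    rewrite G_full // mderiv_linform_exp // bE exprZn scalerA rD scale1r //.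
  by rewrite F_lineE bE exprZn mevalZ mevalXn_linform hy exprMn divff ?lt0r_neq0 // natr1.
- have hg : \prod_(i in S :\ k) h i = \prod_(i in S :\ k) g i.
    by apply: eq_bigr => i; rewrite in_setD1 /h => /andP[/negPf -> _].
  rewrite (big_setD1 k kS) /= [\prod_(i in S :\ k) b i]big_split prodr_const.
  rewrite cardS' /= hg -CE -[RHS]mul1r -[X in _ = X * _]rD (exprS _ d.+1).
  by ring.
Qed.

(** Induction on the number of variables, replacing [F] by its derivative in
    one variable restricted to the face where this variable is [0].  The
    constant telescopes, since passing from [d.+2] to [d.+1] variables costs the
    factor [(d.+1 / d.+2) ^ d.+1].  Equality for [F] forces equality for the
    derivative.  The last equality says that the capacity of the power is [C],
    attained at [1 / b]; the next step of the induction starts from that point. *)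
Theorem capacity_inequality d F S C : completely_superadditive d.+1 F ->
  #|S| = d.+1 -> 0 < C -> capacity_ge S F C ->
  let c := F^`M[indicator S]@_0%MM in
  let bound := d.+1`!%:R / d.+1%:R ^+ d.+1 * C in
  bound <= c /\
  (c <= bound -> exists b, [/\ forall i, i \in S -> 0 < b i,
    forall x, cone S x -> F.@[x] = (linform b S ^+ d.+1).@[x] &
    d.+1%:R ^+ d.+1 * \prod_(i in S) b i = C]).
Proof.
elim: d F S C => [|d IHd] F S C F_cs cardS C_gt0 F_cap c bound.
  have /eqP/cards1P[k SE] := cardS; have [_ F_d _] := F_cs.
  have kS : k \in S by rewrite SE set11.
  have cE : c = F.@[delta R k].
    rewrite (meval_delta _ F_d) mulm1n /c (indicatorD1 kS) SE finset.setDv.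
    have -> : indicator finset.set0 = 0%MM by apply/mnmP => i; rewrite mnmE mnm0E finset.in_set0.
    by rewrite addm0 mderivmU1m mcoeff_mderiv mnm0E mulr1n add0m.
  have boundE : bound = C by rewrite /bound expr1 divr1 mul1r.
  have C_le : C <= c.
    have := F_cap _ (cone_delta R kS); rewrite -cE SE big_set1 /delta eqxx mulr1.
    by apply.
  rewrite boundE; split=> // c_le; have {c_le}cC : c = C by apply: le_anti; rewrite c_le.
  exists (fun=> C); split=> //; last by rewrite SE big_set1 expr1 mul1r.
  move=> x [x_ge0 xS]; rewrite mevalXn_linform expr1 SE big_set1 -cC cE.
  rewrite mulrC -[x k]expr1 -(meval_homog _ _ F_d); apply: meval_eq => i.
  rewrite /delta; case: eqVneq => [->|ik]; first by rewrite mulr1.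
  by rewrite mulr0 xS // SE finset.in_set1.
have /card_gt0P[k kS] : (0 < #|S|)%N by rewrite cardS.
have cardS' : #|S :\ k| = d.+1 by move: cardS; rewrite (cardsD1 k) kS add1n => -[].
have D_gt0 : 0 < d.+2%:R ^+ d.+1 :> R by rewrite exprn_gt0 // ltr0n.
have d_gt0 : 0 < d.+1%:R ^+ d.+1 :> R by rewrite exprn_gt0 // ltr0n.
have C'_gt0 : 0 < C / d.+2%:R ^+ d.+1 * d.+1%:R ^+ d.+1 by rewrite mulr_gt0 // divr_gt0.
have [] := IHd _ _ _ (completely_superadditive_deriv k F_cs) cardS' C'_gt0
  (capacity_ge_deriv F_cs kS C_gt0 F_cap).
have -> : F^`M(k)^`M[indicator (S :\ k)]@_0%MM = c.
  by rewrite /c (indicatorD1 kS) mderivmDm mderivmU1m.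
have -> : d.+1`!%:R / d.+1%:R ^+ d.+1 * (C / d.+2%:R ^+ d.+1 * d.+1%:R ^+ d.+1) = bound.
  rewrite /bound (factS d.+1) natrM (exprS _ d.+1).
  move: (lt0r_neq0 D_gt0) (lt0r_neq0 d_gt0).
  set P := _ ^+ d.+1; set Q := _ ^+ d.+1 => P_neq0 Q_neq0.
  by field; rewrite P_neq0 Q_neq0 -natrD pnatr_eq0.
move=> lb eqc; split=> // /eqc[g [g_gt0 GE gC]].
apply: (equality_step F_cs cardS kS C_gt0 F_cap g_gt0 GE).
apply: (mulIf (lt0r_neq0 d_gt0)); rewrite -mulrA [_ * d.+1%:R ^+ _]mulrC gC.
move: D_gt0; set P := _ ^+ d.+1 => P_gt0.
by field; rewrite lt0r_neq0.
Qed.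

End Capacity.

(** * The theorem *)

Lemma cap1_ge (R : realType) (n : nat) (p : {mpoly R[n]}) :
  nonneg_coeffs p -> 0 < cap1 p -> capacity_ge [set: 'I_n] p (cap1 p).
Proof.
move=> p_ge0 cap_gt0 x [x_ge0 _].
rewrite (eq_bigl (fun=> true)) => [|i]; last by rewrite finset.in_setT.
have X_ge0 : 0 <= \prod_i x i by apply: prodr_ge0.
have [->|X_neq0] := eqVneq (\prod_i x i) 0; first by rewrite mulr0 meval_ge0.
rewrite -ler_pdivlMr ?lt0r ?X_neq0 //; apply: ge_inf.
  exists 0 => _ [z z_gt0 <-]; rewrite divr_ge0 ?meval_ge0 ?prodr_ge0 // => i *;
    exact/ltW/z_gt0.
exists x => // i; rewrite lt0r x_ge0 andbT.
by move: X_neq0; rewrite prodf_seq_neq0 => /allP/(_ i (mem_index_enum i)).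
Qed.

Lemma mpoly0_const (R : realType) (p : {mpoly R[0]}) x : p = p.@[x]%:MP.
Proof.
apply/mpolyP => m; have -> : m = 0%MM by apply/mnmP => -[].
rewrite mcoeffC eqxx mulr1 -meval_at0; apply: meval_eq => -[] //.
Qed.

(* The hypotheses are invariant under scaling of p, while the identity
   p = (sum_i v_i x_i)^n is not: it holds under the normalisation p(1) = 1,
   and fails for instance for p = (x_1 + x_2)^2, where v = (2, 2).  The second
   conjunct is its scale-invariant form, valid for every p. *)
Theorem theorem5p1 (R : realType) (n : nat) (p : {mpoly R[n]})
    (p_ge0 : nonneg_coeffs p)
    (p_homog : p \is n.-homog)
    (p_slc : strongly_log_concave p)
    (cap_eq : p^`M[ [multinom 1%N | i < n] ]
              = (n`!%:R / n%:R ^+ n * cap1 p)%:MP)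
    (cap_gt0 : 0 < n`!%:R / n%:R ^+ n * cap1 p)
    (v : 'I_n -> R) (v_def : forall i, v i = gradient p ones i / n%:R) :
  (p.@[ones] = 1 -> p = (\sum_(i < n) v i *: 'X_i) ^+ n) /\
  p = p.@[ones] *: (\sum_(i < n) (v i / p.@[ones]) *: 'X_i) ^+ n.
Proof.
suff main : p = p.@[ones] *: (\sum_(i < n) (v i / p.@[ones]) *: 'X_i) ^+ n.
  split=> // p1; rewrite [LHS]main p1 scale1r; congr (_ ^+ n).
  by apply: eq_bigr => i _; rewrite divr1.
case: n => [|n] in p p_ge0 p_homog p_slc cap_eq cap_gt0 v v_def *.
  by rewrite expr0 -mul_mpolyC mulr1; apply: mpoly0_const.
have C_gt0 : 0 < cap1 p.
  by move: cap_gt0; rewrite pmulr_rgt0 // divr_gt0 ?exprn_gt0 // ltr0n fact_gt0.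
have p_cs := slc_completely_superadditive p_ge0 p_homog p_slc.
have cardT : #|[set: 'I_n.+1]| = n.+1 by rewrite cardsT card_ord.
have [_] := capacity_inequality p_cs cardT C_gt0 (cap1_ge p_ge0 C_gt0).
have -> : indicator [set: 'I_n.+1] = [multinom 1%N | i < n.+1].
  by apply/mnmP => i; rewrite !mnmE finset.in_setT.
rewrite cap_eq mcoeffC eqxx mulr1 lexx => /(_ isT) [b [b_gt0 pE _]].
have pP : p = linform b [set: 'I_n.+1] ^+ n.+1.
  apply/mpolyP => m; apply/eqP; rewrite -subr_eq0 -mcoeffB; apply/eqP.
  apply: (mcoeff_cone_eq0 (S := [set: _])) => [i|x xT]; first by rewrite finset.in_setT.
  by rewrite mevalB pE // subrr.
pose s := \sum_(i < n.+1) b i.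
have s_gt0 : 0 < s.
  rewrite /s big_ord_recl ltr_wpDr ?b_gt0 ?finset.in_setT //.
  by apply: sumr_ge0 => i _; rewrite ltW // b_gt0 ?finset.in_setT.
have sE : (linform b [set: 'I_n.+1]).@[ones] = s.
  by rewrite meval_linform; apply: eq_big => i; rewrite ?finset.in_setT ?mulr1.
have p1 : p.@[ones] = s ^+ n.+1 by rewrite pP rmorphXn /= sE.
have vE i : v i / p.@[ones] = s^-1 * b i.
  rewrite v_def /gradient p1 pP mderiv_linform_exp ?finset.in_setT // mevalZ rmorphXn /= sE.
  rewrite (exprS s n); have := exprn_gt0 n s_gt0; set P := s ^+ n => P_gt0.
  have N_neq0 : n.+1%:R != 0 :> R by rewrite pnatr_eq0.
  move: N_neq0; move: (n.+1%:R : R) => N N_neq0.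
  by field; rewrite N_neq0 !lt0r_neq0.
rewrite p1 [LHS]pP.
have -> : \sum_(i < n.+1) (v i / s ^+ n.+1) *: 'X_i = s^-1 *: linform b [set: 'I_n.+1].
  rewrite /linform scaler_sumr; apply: eq_big => i; first by rewrite finset.in_setT.
  by rewrite -p1 vE scalerA.
by rewrite exprZn scalerA exprVn divff ?scale1r // expf_neq0 // lt0r_neq0.
Qed.
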